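(* Let $A_1,\ldots,A_m\in\mathbb{M}_d$. Then there exists a unitary matrix $V\in\mathbb{M}_d$ such that $$\left|\sum_{k=1}^m A_k\right|\le\frac{\sqrt{2}}{2}\sum_{k=1}^m\left(|A_k|_{\mathrm{qsym}}+V|A_k|_{\mathrm{qsym}}V^*\right).$$
   Context: $d,m\ge 1$ are integers and $\mathbb{M}_d$ is the space of complex $d\times d$ matrices; $\le$ between Hermitian matrices is the Loewner order. For $A\in\mathbb{M}_d$, $|A|=(A^*A)^{1/2}$, so $|A^*|=(AA^* )^{1/2}$. The quadratic symmetric modulus of $A$ is the positive semidefinite matrix $$|A|_{\mathrm{qsym}}:=\sqrt{\frac{|A|^2+|A^*|^2}{2}}.$$ *)

(* Defs.v *)
From HB Require Import structures.
From mathcomp Require Import all_boot all_order all_algebra.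
From mathcomp Require Import complex reals.
Set Implicit Arguments.
Unset Strict Implicit.
Unset Printing Implicit Defensive.
Import Order.TTheory GRing.Theory Num.Theory.
Local Open Scope ring_scope.
Local Open Scope sesquilinear_scope.

(* 0 <= z in a [numClosedFieldType] says that z is real and nonnegative. *)
Definition psdmx (C : numClosedFieldType) (d : nat) (A : 'M[C]_d) : Prop :=
  A \is hermsymmx /\ forall x : 'cV[C]_d, 0 <= (x ^t* *m A *m x) 0 0.

Definition loewner_le (C : numClosedFieldType) (d : nat) (A B : 'M[C]_d) : Prop :=
  psdmx (B - A).

(* Functional calculus on the spectral decomposition A = S^* D S, meaningful for
   A positive semidefinite: by [sqrtmx_psd], [sqrtmxK] and [sqrtmx_unique] it is
   then the unique positive semidefinite square root of A. *)
Definition sqrtmx (C : numClosedFieldType) (d : nat) (A : 'M[C]_d) : 'M[C]_d :=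
  (spectralmx A) ^t* *m diag_mx (map_mx sqrtC (spectral_diag A)) *m spectralmx A.

Definition absmx (C : numClosedFieldType) (d : nat) (A : 'M[C]_d) : 'M[C]_d :=
  sqrtmx (A ^t* *m A).

(* The quadratic symmetric modulus sqrt ((|A|^2 + |A^*|^2) / 2). *)
Definition qsymmx (C : numClosedFieldType) (d : nat) (A : 'M[C]_d) : 'M[C]_d :=
  sqrtmx (2^-1 *: (absmx A *m absmx A + absmx (A ^t*) *m absmx (A ^t*))).

Lemma hermsymmxE (C : numClosedFieldType) (d : nat) (A : 'M[C]_d) :
  (A \is hermsymmx) = (A == A ^t*).
Proof. by rewrite is_hermitianmxE expr0 scale1r. Qed.

Lemma trmxC_mul (C : numClosedFieldType) (m n p : nat)
  (A : 'M[C]_(m, n)) (B : 'M[C]_(n, p)) : (A *m B) ^t* = B ^t* *m A ^t*.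
Proof. by rewrite trmx_mul map_mxM. Qed.

Lemma psdmx_gram (C : numClosedFieldType) (m d : nat) (A : 'M[C]_(m, d)) :
  psdmx (A ^t* *m A).
Proof.
split=> [|x]; first by rewrite hermsymmxE trmxC_mul trmxCK.
rewrite mulmxA -trmxC_mul -mulmxA mxE sumr_ge0 // => i _.
by rewrite !mxE mulrC mul_conjC_ge0.
Qed.

Lemma psdmxD (C : numClosedFieldType) (d : nat) (A B : 'M[C]_d) :
  psdmx A -> psdmx B -> psdmx (A + B).
Proof.
move=> [hA pA] [hB pB]; split=> [|x].
  move: hA hB; rewrite !hermsymmxE linearD /= map_mxD => /eqP hA /eqP hB.
  by rewrite -hA -hB.
by rewrite mulmxDr mulmxDl mxE addr_ge0.
Qed.

Lemma psdmxZ (C : numClosedFieldType) (d : nat) (a : C) (A : 'M[C]_d) :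
  0 <= a -> psdmx A -> psdmx (a *: A).
Proof.
move=> a0 [hA pA]; split=> [|x].
  move: hA; rewrite !hermsymmxE linearZ /= map_mxZ => /eqP hA.
  by rewrite -hA; apply/eqP; congr (_ *: _); rewrite [RHS]geC0_conj.
by rewrite -scalemxAr -scalemxAl mxE mulr_ge0.
Qed.

Lemma psdmx_spectral (C : numClosedFieldType) (d : nat) (A : 'M[C]_d) :
  psdmx A ->
  A = (spectralmx A) ^t* *m diag_mx (spectral_diag A) *m spectralmx A /\
  forall i, 0 <= spectral_diag A 0 i.
Proof.
move=> [hA pA].
have U := spectral_unitarymx A.
have := orthomx_spectralP (hermitian_normalmx hA).
rewrite invmx_unitary // => E; split=> // i.
have := pA ((spectralmx A) ^t* *m delta_mx i 0); rewrite [X in _ *m X *m _]E.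
move: (spectralmx A) (spectral_diag A) U => S D U.
rewrite trmxC_mul trmxCK !mulmxA !mulmxtVK // -colE mxE mul_mx_diag !mxE !eqxx.
by rewrite /= conjC1 mul1r.
Qed.

Lemma sqrtmx_psd (C : numClosedFieldType) (d : nat) (A : 'M[C]_d) :
  psdmx A -> psdmx (sqrtmx A).
Proof.
move=> /psdmx_spectral [_ D0]; rewrite /sqrtmx.
set S := spectralmx A; set D := spectral_diag A in D0 *.
have -> : S ^t* *m diag_mx (map_mx sqrtC D) *m S =
    (diag_mx (map_mx (sqrtC \o sqrtC) D) *m S) ^t* *m
    (diag_mx (map_mx (sqrtC \o sqrtC) D) *m S).
  rewrite trmxC_mul tr_diag_mx map_diag_mx !mulmxA.
  rewrite -[X in _ = X *m _]mulmxA mulmx_diag.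
  congr (_ *m diag_mx _ *m _); apply/rowP=> i; rewrite !mxE /= geC0_conj ?sqrtC_ge0 //.
  by rewrite -expr2 sqrtCK.
exact: psdmx_gram.
Qed.

Lemma sqrtmxK (C : numClosedFieldType) (d : nat) (A : 'M[C]_d) :
  psdmx A -> sqrtmx A *m sqrtmx A = A.
Proof.
move=> /psdmx_spectral [E _]; rewrite [RHS]E /sqrtmx.
have U := spectral_unitarymx A.
rewrite !mulmxA mulmxtVK // -[X in X *m _ = _]mulmxA mulmx_diag.
congr (_ *m diag_mx _ *m _); apply/rowP=> i.
by rewrite !mxE -expr2 sqrtCK.
Qed.

Lemma sqrtmx_unique (C : numClosedFieldType) (d : nat) (A B : 'M[C]_d) :
  psdmx B -> B *m B = A -> B = sqrtmx A.
Proof.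
move=> pB BA.
have pA : psdmx A.
  have /eqP hB : B == B ^t* by rewrite -hermsymmxE; case: pB.
  by rewrite -BA {1}hB; exact: psdmx_gram.
have [EA DA] := psdmx_spectral pA; have [EB DB] := psdmx_spectral pB.
rewrite /sqrtmx; have UA := spectral_unitarymx A; have UB := spectral_unitarymx B.
move: (spectralmx A) (spectral_diag A) (spectralmx B) (spectral_diag B)
  UA UB EA EB DA DB => S D W E US UW EA EB DA DB.
pose T := W *m S ^t*.
have ET : diag_mx (\row_j (E 0 j ^+ 2)) *m T = T *m diag_mx D.
  have := congr1 (fun M => W *m M *m S ^t*) EA.
  rewrite -BA {1 2}EB /T !mulmxA (unitarymxP UW) mul1mx !mulmxtVK // => <-.
  by rewrite mulmx_diag; congr (diag_mx _ *m _ *m _).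
have ET' : diag_mx E *m T = T *m diag_mx (map_mx sqrtC D).
  clearbody T; apply/matrixP=> i j; have /matrixP/(_ i j) := ET.
  rewrite !mul_diag_mx !mul_mx_diag !mxE.
  have [-> _|nz] := eqVneq (T i j) 0; first by rewrite mulr0 mul0r.
  rewrite mulrC => /(mulfI nz) <-.
  by rewrite sqrCK // mulrC.
have := congr1 (fun M => W ^t* *m M *m S) ET'.
have W'W : W ^t* *m W = 1%:M by apply: mulmx1C; exact/unitarymxP.
have S'S : S ^t* *m S = 1%:M by apply: mulmx1C; exact/unitarymxP.
by rewrite /T !mulmxA W'W mul1mx -EB -mulmxA S'S mulmx1.
Qed.

(* Main.v *)
(* Write S for the sum of the A_k, with polar decomposition S = U |S|.  Then
   |S| is half the sum over k of U^* A_k + A_k^* U.  If A_k = W P with P = |A_k|,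
   then |A_k^*| = W P W^*, and (1 - W^* U)^* P (1 - W^* U) >= 0 reads
   U^* A_k + A_k^* U <= |A_k| + U^* |A_k^*| U.  Since |A_k|^2 and |A_k^*|^2 are at
   most twice the square of the quadratic symmetric modulus of A_k, operator
   monotonicity of the square root bounds |A_k| and |A_k^*| by sqrt 2 times that
   modulus, so V = U^* works. *)
Require Import Defs.
From mathcomp Require Import all_boot all_order all_algebra.
From mathcomp Require Import complex reals.
Set Implicit Arguments.
Unset Strict Implicit.
Unset Printing Implicit Defensive.
Import Order.TTheory GRing.Theory Num.Theory.
Local Open Scope ring_scope.
Local Open Scope sesquilinear_scope.

(** * Conjugate transposes and positive semidefinite matrices *)

Section PsdMatrices.
Variable C : numClosedFieldType.

Lemma trmxCD m n (A B : 'M[C]_(m, n)) : (A + B) ^t* = A ^t* + B ^t*.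
Proof. by rewrite linearD map_mxD. Qed.

Lemma trmxCB m n (A B : 'M[C]_(m, n)) : (A - B) ^t* = A ^t* - B ^t*.
Proof. by rewrite linearB map_mxB. Qed.

Lemma trmxC1 n : (1%:M : 'M[C]_n) ^t* = 1%:M.
Proof. by rewrite tr_scalar_mx map_scalar_mx /= conjC1. Qed.

Lemma trmxC_sum m n I (r : seq I) (F : I -> 'M[C]_(m, n)) :
  (\sum_(i <- r) F i) ^t* = \sum_(i <- r) (F i) ^t*.
Proof.
elim: r => [|i r IH]; last by rewrite !big_cons trmxCD IH.
by rewrite !big_nil trmx0 map_mx0.
Qed.

Lemma psdmx_herm n (A : 'M[C]_n) : psdmx A -> A ^t* = A.
Proof. by case; rewrite hermsymmxE => /eqP <-. Qed.

(** With R the Hermitian square root of [A], the congruence is the Gram matrix of R [B]. *)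
Lemma psdmx_congr m n (A : 'M[C]_m) (B : 'M[C]_(m, n)) :
  psdmx A -> psdmx (B ^t* *m A *m B).
Proof.
move=> pA; rewrite -(sqrtmxK pA) -{1}(psdmx_herm (sqrtmx_psd pA)).
by rewrite mulmxA -trmxC_mul -mulmxA; exact: psdmx_gram.
Qed.

Lemma psdmx_sum n I (r : seq I) (F : I -> 'M[C]_n) :
  (forall i, psdmx (F i)) -> psdmx (\sum_(i <- r) F i).
Proof.
move=> pF; elim: r => [|i r IH]; last by rewrite big_cons; exact: psdmxD.
by have := psdmx_gram (0 : 'M[C]_n); rewrite big_nil mulmx0.
Qed.

(** Each diagonal entry of the product is the sum of the squared moduli of a row of [A]. *)
Lemma gram_eq0 m n (A : 'M[C]_(m, n)) : A *m A ^t* = 0 -> A = 0.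
Proof.
move=> A0; apply/matrixP=> i j; rewrite [RHS]mxE.
have /matrixP/(_ i i) := A0; rewrite !mxE => S0.
have /psumr_eq0P/(_ S0 j isT) : forall k, true -> 0 <= A i k * (A ^t*) k i.
  by move=> k _; rewrite !mxE mul_conjC_ge0.
by rewrite !mxE => /eqP; rewrite mul_conjC_eq0 => /eqP.
Qed.

(** * Operator monotonicity of the square root *)

Lemma psdmx_spectral_ge0 n (A : 'M[C]_n) :
  A \is hermsymmx -> (forall i, 0 <= spectral_diag A 0 i) -> psdmx A.
Proof.
move=> hA D0; have := orthomx_spectralP (hermitian_normalmx hA).
(* Congruence by the spectral basis reduces the claim to a diagonal matrix. *)
rewrite invmx_unitary ?spectral_unitarymx // => ->; apply: psdmx_congr.
move: (spectral_diag A) D0 => D D0; split=> [|x].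
  rewrite hermsymmxE tr_diag_mx map_diag_mx; apply/eqP; congr diag_mx.
  by apply/rowP=> i; rewrite mxE /= geC0_conj.
rewrite -mulmxA mul_diag_mx mxE sumr_ge0 // => i _; rewrite !mxE.
by rewrite mulrCA mulr_ge0 // mulrC mul_conjC_ge0.
Qed.

(* A unit eigenvector x of B - A with eigenvalue l gives
   l = x^* B x - x^* A x and
   0 <= x^* (B^2 - A^2) x = l (x^* B x + x^* A x) = (x^* B x)^2 - (x^* A x)^2. *)
Lemma psdmx_sqr_le n (A B : 'M[C]_n) :
  psdmx A -> psdmx B -> loewner_le (A *m A) (B *m B) -> loewner_le A B.
Proof.
move=> pA pB [_ pAB]; rewrite /loewner_le; set H := B - A.
have hH : H ^t* = H by rewrite trmxCB !psdmx_herm.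
have hermH : H \is hermsymmx by rewrite hermsymmxE hH.
apply: psdmx_spectral_ge0 => // i.
set l := spectral_diag H 0 i; pose S := spectralmx H.
have US : S \is unitarymx := spectral_unitarymx H.
pose x : 'cV_n := S ^t* *m delta_mx i 0.
have xx : x ^t* *m x = 1%:M.
  rewrite trmxC_mul trmxCK !mulmxA mulmxtVK //.
  by apply/rowP=> j; rewrite -colE ord1 !mxE !eqxx /= conjC1.
have Hx : H *m x = l *: x.
  have := orthomx_spectralP (hermitian_normalmx hermH).
  rewrite invmx_unitary // -/S => {1}->.
  rewrite /x !mulmxA mulmxtVK // scalemxAr -mulmxA; congr (_ *m _).
  apply/matrixP=> j k; rewrite mul_diag_mx !mxE.
  by have [->|] := eqVneq j i; rewrite //= !mulr0.
clearbody x.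
have lr : l ^* = l.
  apply: conj_Creal.
  by have /mxOverP/(_ 0 i) := hermitian_spectral_diag_real hermH.
have xH : x ^t* *m H = l *: x ^t*.
  by rewrite -{1}hH -trmxC_mul Hx linearZ /= map_mxZ /= lr.
have [_ /(_ x) a0] := pA; have [_ /(_ x) b0] := pB.
have lE : l = (x ^t* *m B *m x) 0 0 - (x ^t* *m A *m x) 0 0.
  transitivity ((x ^t* *m H *m x) 0 0).
    by rewrite xH -scalemxAl xx !mxE eqxx mulr1.
  by rewrite mulmxBr mulmxBl !mxE.
have := pAB x.
have -> : B *m B - A *m A = B *m H + H *m A.
  by rewrite mulmxBr mulmxBl addrA subrK.
rewrite mulmxDr mulmxDl !mulmxA xH.
rewrite -[_ *m H *m x]mulmxA Hx -!scalemxAl -scalemxAr -scalerDr.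
rewrite mxE [X in _ * X]mxE.
move: lE a0 b0; set a := (X in _ - X); set b := (X in X - _) => lE a0 b0.
rewrite lE -subr_sqr subr_ge0 subr_ge0.
by rewrite ler_sqr.
Qed.

(** * Unitary extension and polar decomposition *)

Lemma unitarymx_extension r k (E : 'M[C]_(r, r + k)) :
  E \is unitarymx -> exists E' : 'M[C]_(k, r + k), col_mx E E' \is unitarymx.
Proof.
move=> UE.
(* [K] spans the orthogonal complement of the rows of [E]; Gram-Schmidt on a basis of it supplies
   the [k] missing rows. *)
pose K := orthomx Num.Def.conjC (mx_of_hermitian (hermitian1mx _)) E.
have rK : \rank K = k by rewrite rank_ortho mxrank_unitary // addKn.
have UF := schmidt_unitarymx (row_base K) (rank_leq_col _).
have : (schmidt (row_base K) <= K)%MS.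
  by rewrite eqmx_schmidt_free ?row_base_free // eq_row_base.
move: (schmidt (row_base K)) UF; rewrite rK => F UF.
rewrite orthomx1E => /eqP FE; exists F; apply/unitarymxP.
rewrite tr_col_mx map_row_mx mul_col_row (unitarymxP UE) (unitarymxP UF) FE.
by rewrite -[E *m _]trmxCK trmxC_mul trmxCK FE trmx0 map_mx0 -scalar_mx_block.
Qed.

Lemma isometry_extension r n (E F : 'M[C]_(r, n)) :
  E \is unitarymx -> F \is unitarymx ->
  exists U : 'M[C]_n, U \is unitarymx /\ E *m U = F.
Proof.
move=> UE; have rn : (r <= n)%N by rewrite -(mxrank_unitary UE) rank_leq_col.
move: E F UE; rewrite -(subnKC rn) => E F UE UF.
have [E' UE'] := unitarymx_extension UE.
have [F' UF'] := unitarymx_extension UF.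
(* This unitary carries the completed basis of [E] to that of [F]: by orthonormality [E] times the
   first factor is the block row (1 0), which selects [F]. *)
exists ((col_mx E E') ^t* *m col_mx F F'); split.
  by rewrite mul_unitarymx // trmxC_unitary.
have := unitarymxP UE'; rewrite tr_col_mx map_row_mx mul_col_row scalar_mx_block.
move=> /eq_block_mx [EE EE' _ _].
by rewrite mulmxA mul_mx_row EE EE' mul_row_col mul1mx mul0mx addr0.
Qed.

(* With the rows of Q an orthonormal basis of the row space of A, M = A Q^* has
   full column rank, so W = M (M^* M)^(-1/2) is an isometry; any unitary
   sending Q^* to W is a polar factor of A. *)
Lemma polar_decomposition n (A : 'M[C]_n) :
  exists U : 'M[C]_n, U \is unitarymx /\ A = U *m absmx A.
Proof.
pose Q := schmidt (row_base A).
have UQ : Q \is unitarymx := schmidt_unitarymx _ (rank_leq_col A).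
pose M := A *m Q ^t*.
have AE : A = M *m Q.
  have /submxP [X AX] : (A <= Q)%MS.
    by rewrite eqmx_schmidt_free ?row_base_free // eq_row_base.
  suff -> : M = X by [].
  by rewrite /M [Y in Y *m _]AX mulmxtVK.
clearbody M.
have freeM : row_free (M ^t*).
  rewrite /row_free mxrank_map mxrank_tr eqn_leq rank_leq_col /=.
  by rewrite {1}AE mxrankM_maxl.
pose P := sqrtmx (M ^t* *m M).
have pP : psdmx P := sqrtmx_psd (psdmx_gram M).
have PP : P *m P = M ^t* *m M := sqrtmxK (psdmx_gram M).
clearbody P.
(* If [v] [P] = 0, then [v] [M]^* [M] [v]^* = 0, so [v] [M]^* = 0, and [v] = 0 because [M]^* is row
   free. *)
have uP : P \in unitmx.
  rewrite -row_free_unit; apply: inj_row_free => v vP.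
  apply: (row_free_inj freeM); rewrite mul0mx; apply: gram_eq0.
  by rewrite trmxC_mul trmxCK mulmxA -[_ *m _ *m M]mulmxA -PP !mulmxA vP !mul0mx.
pose W := M *m invmx P.
have UW : W ^t* \is unitarymx.
  apply/unitarymxP; rewrite trmxCK /W trmxC_mul mulmxA -[_ *m _ *m M]mulmxA -PP.
  rewrite trmx_inv map_invmx psdmx_herm // !mulmxA mulVmx // mul1mx mulmxV //.
have [U [UU QU]] := isometry_extension UQ UW.
exists (U ^t*); rewrite trmxC_unitary; split=> //.
(* The square is [Q]^* [M]^* [M] [Q] = [A]^* [A] because [Q] [Q]^* = 1, so uniqueness of the root
   applies. *)
have <- : Q ^t* *m P *m Q = absmx A.
  apply: sqrtmx_unique; first exact: psdmx_congr.
  by rewrite !mulmxA mulmxtVK // -[_ *m P *m P]mulmxA PP !mulmxA -trmxC_mul -AE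
    -mulmxA -AE.
by rewrite !mulmxA -trmxC_mul QU trmxCK /W mulmxKV.
Qed.

(** * Comparison of the moduli of a matrix and its adjoint *)

Lemma absmx_psd n (A : 'M[C]_n) : psdmx (absmx A).
Proof. exact: sqrtmx_psd (psdmx_gram A). Qed.

Lemma absmxK n (A : 'M[C]_n) : absmx A *m absmx A = A ^t* *m A.
Proof. exact: sqrtmxK (psdmx_gram A). Qed.

Lemma unitary_trmxC_mul n (U : 'M[C]_n) : U \is unitarymx -> U ^t* *m U = 1%:M.
Proof. by move=> UU; apply: mulmx1C; exact/unitarymxP. Qed.

(** The right-hand side is positive semidefinite with square [W] |A|^2 [W]^* = [A] [A]^*. *)
Lemma absmx_trmxC n (A W : 'M[C]_n) :
  W \is unitarymx -> A = W *m absmx A -> absmx (A ^t*) = W *m absmx A *m W ^t*.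
Proof.
move=> UW; move: (absmx A) (absmx_psd A) => P pP ->.
symmetry; apply: sqrtmx_unique.
  by rewrite -{1}[W]trmxCK; exact: psdmx_congr.
rewrite trmxCK trmxC_mul (psdmx_herm pP) !mulmxA.
by rewrite -[_ *m W ^t* *m W]mulmxA unitary_trmxC_mul // mulmx1.
Qed.

Lemma cross_term_le n (A U : 'M[C]_n) : U \is unitarymx ->
  loewner_le (U ^t* *m A + A ^t* *m U)
    (absmx A + U ^t* *m absmx (A ^t*) *m U).
Proof.
move=> UU; have [W [UW AE]] := polar_decomposition A.
rewrite (absmx_trmxC UW AE) /loewner_le.
move: (absmx A) (absmx_psd A) AE => P pP ->.
have := psdmx_congr (1%:M - W ^t* *m U) pP.
rewrite trmxCB trmxC1 !trmxC_mul trmxCK (psdmx_herm pP).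
rewrite mulmxBr mulmx1 !mulmxBl mul1mx !mulmxA.
by congr psdmx; rewrite !opprB opprD !addrA [P - _ + _]addrAC.
Qed.

Lemma absmx_le_qsymmx n (A : 'M[C]_n) :
  loewner_le (absmx A) (sqrtC 2 *: qsymmx A) /\
  loewner_le (absmx (A ^t*)) (sqrtC 2 *: qsymmx A).
Proof.
have p2V : 0 <= 2^-1 :> C by rewrite invr_ge0 ler0n.
have p2 : 0 <= sqrtC 2 :> C by rewrite sqrtC_ge0 ler0n.
set T := absmx A *m absmx A + absmx (A ^t*) *m absmx (A ^t*).
have pT : psdmx (2^-1 *: T).
  apply: psdmxZ => //; rewrite /T !absmxK.
  by apply: psdmxD; exact: psdmx_gram.
have pQ : psdmx (sqrtC 2 *: qsymmx A) := psdmxZ p2 (sqrtmx_psd pT).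
have QQ : (sqrtC 2 *: qsymmx A) *m (sqrtC 2 *: qsymmx A) = T.
  rewrite -scalemxAl -scalemxAr scalerA -expr2 sqrtCK (sqrtmxK pT).
  by rewrite scalerA mulfV ?pnatr_eq0 // scale1r.
(* Removing one squared modulus from [T] leaves the other, which is a Gram matrix. *)
split; apply: (psdmx_sqr_le (absmx_psd _) pQ); rewrite QQ /loewner_le /T.
  by rewrite addrAC subrr add0r absmxK; exact: psdmx_gram.
by rewrite addrK absmxK; exact: psdmx_gram.
Qed.

(** * Calculus of the Loewner order *)

Lemma loewner_le_trans n (A B D : 'M[C]_n) :
  loewner_le A B -> loewner_le B D -> loewner_le A D.
Proof.
rewrite /loewner_le => pAB pBD; rewrite -(subrK B D) -addrA.
exact: psdmxD.
Qed.

Lemma loewner_leD n (A B D E : 'M[C]_n) :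
  loewner_le A B -> loewner_le D E -> loewner_le (A + D) (B + E).
Proof.
by rewrite /loewner_le => pAB pDE; rewrite opprD addrACA; exact: psdmxD.
Qed.

Lemma loewner_le_sum n I (r : seq I) (F G : I -> 'M[C]_n) :
  (forall i, loewner_le (F i) (G i)) ->
  loewner_le (\sum_(i <- r) F i) (\sum_(i <- r) G i).
Proof. by move=> FG; rewrite /loewner_le -sumrB; exact: psdmx_sum. Qed.

Lemma loewner_leZ n (a : C) (A B : 'M[C]_n) :
  0 <= a -> loewner_le A B -> loewner_le (a *: A) (a *: B).
Proof. by move=> a0 pAB; rewrite /loewner_le -scalerBr; exact: psdmxZ. Qed.

Lemma loewner_le_congr m n (A B : 'M[C]_m) (D : 'M[C]_(m, n)) :
  loewner_le A B -> loewner_le (D ^t* *m A *m D) (D ^t* *m B *m D).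
Proof.
by move=> pAB; rewrite /loewner_le -mulmxBl -mulmxBr; exact: psdmx_congr.
Qed.

End PsdMatrices.

Theorem corollary2p3 (R : realType) (d m : nat) (hd : (0 < d)%N) (hm : (0 < m)%N)
  (A : 'I_m -> 'M[R[i]]_d) :
  exists V : 'M[R[i]]_d, V \is unitarymx /\
    loewner_le (absmx (\sum_(k < m) A k))
      ((sqrtC 2 / 2) *:
        \sum_(k < m) (qsymmx (A k) + V *m qsymmx (A k) *m V ^t*)).
Proof.
set S := \sum_(k < m) A k; have [U [UU SE]] := polar_decomposition S.
have US : U ^t* *m S = absmx S.
  by rewrite {1}SE mulmxA unitary_trmxC_mul // mul1mx.
exists (U ^t*); rewrite trmxC_unitary trmxCK; split=> //.
(* |S| = [U]^* [S] is Hermitian, hence equal to the average of [U]^* [S] and its adjoint. *)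
have -> : absmx S = 2^-1 *: \sum_(k < m) (U ^t* *m A k + (A k) ^t* *m U).
  rewrite big_split /= -mulmx_sumr -mulmx_suml -trmxC_sum -/S US.
  rewrite -[U in S ^t* *m U]trmxCK -trmxC_mul US psdmx_herm; last exact: absmx_psd.
  by rewrite -mulr2n -[absmx S *+ 2]scaler_nat scalerA mulVf ?pnatr_eq0 // scale1r.
(* The factor 1/2 comes from that average; the root of 2 is left for the bounds by [qsymmx]. *)
rewrite [sqrtC 2 / 2]mulrC -scalerA; apply: loewner_leZ.
  by rewrite invr_ge0 ler0n.
rewrite scaler_sumr; apply: loewner_le_sum => k.
apply: loewner_le_trans (cross_term_le (A k) UU) _.
have [le1 le2] := absmx_le_qsymmx (A k).
rewrite scalerDr; apply: (loewner_leD le1).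
by rewrite scalemxAl scalemxAr; exact: loewner_le_congr.
Qed.
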